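(* Let $\mu>0$ and let $h$ be an intensity function with $\int_0^{\infty} h(y)\,dy =\infty$ such that $\lim_{x\to \infty}\frac{xh'(x)}{h(x)}$ exists. Then $\lim_{x_e\to \infty}PoA(h, x_e)$ exists and $$\lim_{x_e\to \infty}PoA(h, x_e)=2+\lim_{x\to \infty}\frac{xh'(x)}{h(x)}.$$
   Context: Fix $\mu>0$ (service rate) and $c_t>0$ (travel cost per unit distance). An intensity function is a nonnegative measurable function $h$ on $[0,\infty)$ such that $\lambda(x)=\int_0^x h(y)\,dy$ is finite for all $x\ge 0$. In the M/G/1/1 loss system, customers with distance less than $x$ from the server arrive as a Poisson process of rate $\lambda(x)$; a customer joins only if the server is idle and his distance is at most the threshold in use. The service value is $R$, the waiting cost per unit time is $c_w$, and $x_e=\frac{R\mu-c_w}{c_t\mu}>0$ is the Nash equilibrium threshold (treated as a positive parameter, with $\mu$ and $h$ fixed). The expected social benefit per unit time with threshold $x\ge 0$ is $$S(x)=\frac{c_t\int_0^x (x_e-y)h(y)\,dy}{1+\frac1\mu\int_0^x h(y)\,dy}.$$ The socially optimal threshold $x^*$ (which maximizes $S$ over $x\ge0$) is the unique $x\ge 0$ satisfying $x_e=\frac1\mu\int_0^{x}(x-y)h(y)\,dy+x$; it depends on $x_e$, $h$ and $\mu$. The price of anarchy is $$PoA(h,x_e)=\frac{S(x^* )}{S(x_e)}=\frac{\int_{0}^{x^*} (x_e-y)h(y)\,dy}{\int_{0}^{x_e} (x_e-y)h(y)\,dy}\cdot\frac{1+\frac{1}{\mu} \int_{0}^{x_e}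 h(y)\,dy}{1+\frac{1}{\mu} \int_{0}^{x^*} h(y)\,dy}$$ (defined whenever $\int_0^{x_e}h(y)\,dy>0$; $c_t$ cancels). Existence of $\lim_{x\to\infty} xh'(x)/h(x)$ includes that $h$ is differentiable and nonzero for all sufficiently large $x$. Limits are allowed to equal $+\infty$, with $2+\infty=\infty$. *)

(* Defs.v *)
From mathcomp Require Import all_boot all_order all_algebra.
From mathcomp Require Import all_classical all_reals all_analysis.
From mathcomp Require Import measurable_realfun.
From mathcomp Require Import ring lra.
Import Order.TTheory GRing.Theory Num.Theory.
Import numFieldNormedType.Exports.

Set Implicit Arguments.
Unset Strict Implicit.
Unset Printing Implicit Defensive.

Local Open Scope classical_set_scope.
Local Open Scope ring_scope.

(* Only the values of [h] on the nonnegative reals matter. *)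
Definition intensity (R : realType) (h : R -> R) : Prop :=
  [/\ forall x, 0 <= x -> 0 <= h x,
      measurable_fun (`[0, +oo[ : set R) h &
      forall x, 0 <= x ->
        (\int[lebesgue_measure]_(y in `[0%R, x]) (h y)%:E < +oo)%E].

Definition social_benefit (R : realType) (h : R -> R) (mu ct xe x : R) : R :=
  (ct * \int[lebesgue_measure]_(y in `[0, x]) ((xe - y) * h y)) /
  (1 + mu^-1 * \int[lebesgue_measure]_(y in `[0, x]) h y).

Definition social_threshold_eq (R : realType) (h : R -> R) (mu xe x : R) :
    Prop :=
  0 <= x /\
  xe = mu^-1 * \int[lebesgue_measure]_(y in `[0, x]) ((x - y) * h y) + x.

(* The default value 0 is irrelevant when [0 < mu], [0 <= xe] and [h] is an
   intensity function: [social_threshold_eq] then has exactly one solution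
   ([social_thresholdP], [social_threshold_uniq]), and that solution maximizes
   the social benefit ([social_threshold_max]). *)
Definition social_threshold (R : realType) (h : R -> R) (mu xe : R) : R :=
  xget 0 [set x | social_threshold_eq h mu xe x].

Definition PoA (R : realType) (h : R -> R) (mu ct xe : R) : R :=
  social_benefit h mu ct xe (social_threshold h mu xe) /
  social_benefit h mu ct xe xe.

Section SocialThreshold.
Context {R : realType} (h : R -> R) (mu : R).
Hypotheses (mu_gt0 : 0 < mu) (h_intensity : intensity h).
Notation leb := (@lebesgue_measure R).

Let mass x := \int[leb]_(y in `[0, x]) h y.
Let moment x := \int[leb]_(y in `[0, x]) (y * h y).

Let h_ge0 x : 0 <= x -> 0 <= h x.
Proof. by case: h_intensity => hge0 _ _; exact: hge0. Qed.

Let in0x (x y : R) : `[0, x]%classic y -> 0 <= y <= x.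
Proof. by rewrite /= in_itv. Qed.

Let mI (x : R) : measurable (`[0, x]%classic : set (measurableTypeR R)).
Proof. exact: measurable_itv. Qed.

Let h_meas x : measurable_fun (`[0, x] : set R) h.
Proof.
case: h_intensity => _ mh _; apply: (measurable_funS _ _ mh) => //.
by move=> y /in0x/andP[y0 _]; rewrite /= in_itv/= y0.
Qed.

Let h_int x : 0 <= x -> leb.-integrable `[0, x] (EFin \o h).
Proof.
move=> x0; apply/integrableP; split.
  by apply/measurable_EFinP; exact: h_meas.
case: h_intensity => _ _ /(_ _ x0); apply: le_lt_trans.
rewrite le_eqVlt; apply/orP; left; apply/eqP; apply: eq_integral => y.
by rewrite inE => /in0x/andP[y0 _] /=; rewrite ger0_norm// h_ge0.
Qed.

Let yh_int x : 0 <= x -> leb.-integrable `[0, x] (EFin \o (fun y => y * h y)).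
Proof.
move=> x0.
have ix : leb.-integrable `[0, x] (EFin \o (fun y => x * h y)).
  have /= := integrableZl (mI x) x (h_int x0).
  by apply: eq_integrable => //= y _; rewrite EFinM.
apply: le_integrable ix => //.
  by apply/measurable_EFinP; apply: measurable_funM => //; exact: h_meas.
move=> y /in0x/andP[y0 yx] /=.
by rewrite lee_fin !normrM ler_wpM2r// !ger0_norm// (le_trans y0).
Qed.

Let integral_aff a x : 0 <= x ->
  \int[leb]_(y in `[0, x]) ((a - y) * h y) = a * mass x - moment x.
Proof.
move=> x0; rewrite -RintegralZl//; last exact: h_int.
rewrite -RintegralB//; last exact: yh_int.
  by apply: eq_Rintegral => y _; rewrite mulrBl.
have /= := integrableZl (mI x) a (h_int x0).
by apply: eq_integrable => //= y _; rewrite EFinM.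
Qed.

(* [x |-> \int_0^x (a - y) h(y) dy] is monotone on either side of [a]. *)
Let aff_le a x z : 0 <= x -> 0 <= z -> (x <= z <= a \/ a <= z <= x) ->
  a * mass x - moment x <= a * mass z - moment z.
Proof.
have int_aff t : 0 <= t ->
    leb.-integrable `[0, t] (EFin \o (fun y => (a - y) * h y)).
  move=> t0; have /= := integrableB (mI t)
    (integrableZl (mI t) a (h_int t0)) (yh_int t0).
  by apply: eq_integrable => //= y _; rewrite mulrBl EFinB EFinM.
have splt s t : 0 <= s -> s <= t ->
    a * mass t - moment t - (a * mass s - moment s) =
    \int[leb]_(y in `]s, t]) ((a - y) * h y).
  move=> s0 st; rewrite -!integral_aff ?(le_trans s0)//.
  apply: Rintegral_itvB; rewrite ?bnd_simp//.
  exact: int_aff (le_trans s0 st).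
move=> x0 z0 [/andP[xz za]|/andP[az zx]]; rewrite -subr_ge0.
  rewrite splt//; apply: Rintegral_ge0 => y.
  rewrite /= in_itv/= => /andP[xy yz].
  by rewrite mulr_ge0 ?h_ge0 ?subr_ge0 ?(le_trans yz)// (le_trans x0)// ltW.
have zs : `]z, x]%classic `<=` `[0, x]%classic.
  by move=> y; rewrite /= !in_itv/= => /andP[zy ->];
    rewrite (le_trans z0)// ltW.
rewrite -opprB splt// oppr_ge0.
have -> : 0 = \int[leb]_(y in `]z, x]) (fun=> 0 : R) y.
  by rewrite Rintegral_cst// mul0r.
apply: le_Rintegral => //.
- by apply: integrableS (int_aff _ x0).
- exact: integrable0.
move=> y; rewrite /= in_itv/= => /andP[zy yx].
by rewrite mulr_le0_ge0 ?h_ge0 ?subr_le0 ?(le_trans az) ?(le_trans z0) ?ltW.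
Qed.

Let mass_ge0 x : 0 <= mass x.
Proof. by apply: Rintegral_ge0 => y /in0x/andP[y0 _]; exact: h_ge0. Qed.

Let threshold_eqE xe x : 0 <= x ->
  (xe = mu^-1 * \int[leb]_(y in `[0, x]) ((x - y) * h y) + x) <->
  (mu * (xe - x) = x * mass x - moment x).
Proof.
move=> x0; rewrite integral_aff//; have mu0 : mu != 0 by rewrite gt_eqF.
split=> [->|<-]; last by rewrite mulKf// subrK.
by rewrite addrK mulrA divff// mul1r.
Qed.

Lemma social_threshold_uniq xe x x' :
  social_threshold_eq h mu xe x -> social_threshold_eq h mu xe x' -> x = x'.
Proof.
have le_sol s t :
    social_threshold_eq h mu xe s -> social_threshold_eq h mu xe t ->
    s <= t -> t <= s.
  move=> [s0 /threshold_eqE-/(_ s0) es] [t0 /threshold_eqE-/(_ t0) et] st.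
  have : t * mass s - moment s <= t * mass t - moment t.
    by apply: aff_le => //; left; rewrite st lexx.
  rewrite -et => Ht; have := ler_wpM2r (mass_ge0 s) st => Hs.
  rewrite -(ler_pM2l mu_gt0); move: es Ht Hs; lra.
move=> hx hx'; apply/eqP; rewrite eq_le.
have /orP[le|le] := le_total x x'; first by rewrite le (le_sol _ _ hx hx').
by rewrite le (le_sol _ _ hx' hx).
Qed.

Lemma social_thresholdP xe : 0 <= xe ->
  social_threshold_eq h mu xe (social_threshold h mu xe).
Proof.
move=> xe0; rewrite /social_threshold.
suff [x hx] : exists x, social_threshold_eq h mu xe x.
  exact: (xgetPex 0 (ex_intro _ x hx)).
pose f x := x * mass x - moment x + mu * x.
have cf : {within `[0, xe], continuous f}.
  have cmass := parameterized_integral_continuous xe0 (h_int xe0).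
  have cmom := parameterized_integral_continuous xe0 (yh_int xe0).
  move=> x; have cid : {for x, continuous (fun y : subspace `[0, xe] => y : R)}.
    exact: (continuous_subspaceT (fun=> @cvg_id _ _)).
  apply: cvgD; last by apply: cvgM; [exact: cvg_cst | exact: cid].
  by apply: cvgB; [apply: cvgM; [exact: cid|exact: cmass] | exact: cmom].
have mass0 : mass 0 = 0 by rewrite /mass set_itv1 Rintegral_set1.
have mom0 : moment 0 = 0 by rewrite /moment set_itv1 Rintegral_set1.
have f0 : f 0 = 0 by rewrite /f mass0 mom0; ring.
have fxe : mu * xe <= f xe.
  rewrite /f lerDr; have := @aff_le xe 0 xe (lexx _) xe0.
  by rewrite mass0 mom0 mulr0 subr0 xe0 lexx; apply; left.
have muxe0 : 0 <= mu * xe by rewrite mulr_ge0// ltW.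
have [|c] := IVT (v := mu * xe) xe0 cf.
  by rewrite f0 ge_min muxe0 le_max fxe orbT.
rewrite in_itv/= => /andP[c0 _] fc; exists c; split => //.
by apply/threshold_eqE => //; rewrite mulrBr -fc /f addrK.
Qed.

Lemma social_threshold_max ct xe x : 0 <= ct -> 0 <= xe -> 0 <= x ->
  social_benefit h mu ct xe x <=
  social_benefit h mu ct xe (social_threshold h mu xe).
Proof.
move=> ct0 xe0 x0; have [] := social_thresholdP xe0.
set s := social_threshold h mu xe => s0 /threshold_eqE-/(_ s0) es.
have den t : 0 < 1 + mu^-1 * mass t.
  by rewrite ltr_wpDr// mulr_ge0// invr_ge0 ltW.
rewrite /social_benefit -!/(mass _) !integral_aff// -!mulrA ler_wpM2l//.
have -> : xe * mass s - moment s = mu * (xe - s) * (1 + mu^-1 * mass s).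
  have -> : xe * mass s - moment s = mu * (xe - s) + (xe - s) * mass s.
    by rewrite es; ring.
  by field; rewrite gt_eqF.
rewrite mulfK ?gt_eqF// ler_pdivrMr//.
have -> : mu * (xe - s) * (1 + mu^-1 * mass x) =
    mu * (xe - s) + (xe - s) * mass x by field; rewrite gt_eqF.
have : s * mass x - moment x <= s * mass s - moment s.
  by apply: aff_le => //; have [xs|/ltW sx] := leP x s;
    [left|right]; apply/andP.
rewrite es; lra.
Qed.

End SocialThreshold.

(* Main.v *)
(* Write H(x) for the integral of h over [0, x] and W(x) for that of H, that is,
   of (x - y) h(y).  The threshold equation for s = x^* reads mu (xe - s) = W(s)
   and turns the price of anarchy into
     PoA = (1 - s / xe) (1 + mu / H(xe)) (xe H(xe) / W(xe)).
   Since H tends to infinity, so does W(x) / x, hence s / xe tends to 0 and PoA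
   behaves as xe H(xe) / W(xe).  Two applications of l'Hopital's rule finish:
   the limits of x h'/h, x h/H and x H/W exist and each exceeds the previous
   one by 1. *)
Require Import Defs.
From mathcomp Require Import all_boot all_order all_algebra.
From mathcomp Require Import all_classical all_reals all_analysis.
From mathcomp Require Import measurable_realfun ring lra.
Import Order.TTheory GRing.Theory Num.Theory.
Import numFieldNormedType.Exports.
Set Implicit Arguments.
Unset Strict Implicit.
Unset Printing Implicit Defensive.
Local Open Scope classical_set_scope.
Local Open Scope ring_scope.

(** * Limits at infinity in the extended reals, and l'Hopital's rule *)

Lemma cvg_EFin_bounds (R : realType) (F : R -> R) (l : \bar R) :
  (forall a : R, (a%:E < l)%E -> \forall x \near +oo, a < F x) ->
  (forall b : R, (l < b%:E)%E -> \forall x \near +oo, F x < b) ->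
  (F x)%:E @[x --> +oo] --> l.
Proof.
case: l => [r| |] lo up.
- apply: cvg_EFin; first exact: nearW.
  apply/cvgrPdist_lt => e e0; near=> x.
  have lox : r - e < F x.
    by near: x; apply: lo; rewrite lte_fin ltrBlDr ltrDl.
  have upx : F x < r + e by near: x; apply: up; rewrite lte_fin ltrDl.
  by rewrite /= ltr_distlC lox upx.
- by apply/cvgeyPgt => A; have := lo A (ltry _); apply: filterS.
- by apply/cvgeNyPlt => A; have := up A (ltNyr _); apply: filterS.
Unshelve. all: by end_near. Qed.

Lemma cvg_EFin_gt (R : realType) (F : R -> R) (l : \bar R) (a : R) :
  (F x)%:E @[x --> +oo] --> l -> (a%:E < l)%E -> \forall x \near +oo, a < F x.
Proof.
move=> Fl al.
have : \forall x \near +oo, (a%:E < (F x)%:E)%E := Fl _ (open_ereal_gt' al).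
by apply: filterS => x; rewrite lte_fin.
Qed.

Lemma cvg_EFin_lt (R : realType) (F : R -> R) (l : \bar R) (b : R) :
  (F x)%:E @[x --> +oo] --> l -> (l < b%:E)%E -> \forall x \near +oo, F x < b.
Proof.
move=> Fl lb.
have : \forall x \near +oo, ((F x)%:E < b%:E)%E := Fl _ (open_ereal_lt' lb).
by apply: filterS => x; rewrite lte_fin.
Qed.

(** By the mean value theorem f - c g is eventually nondecreasing, so f is at least c g plus a
    constant; as g grows, the gap c - c' absorbs that constant. Nothing is asked of the limit of
    f. *)
Lemma ratio_gt_of_derive_ge (R : realType) (f df g dg : R -> R) (c' c : R) :
  (\forall x \near +oo, is_derive (x : R) 1 f (df x)) ->
  (\forall x \near +oo, is_derive (x : R) 1 g (dg x)) ->
  (\forall x \near +oo, c * dg x <= df x) ->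
  g x @[x --> +oo] --> +oo -> c' < c ->
  \forall x \near +oo, c' < f x / g x.
Proof.
move=> fdf gdg cdf gy c'c.
have [A [_ HA]] : \forall x \near +oo, [/\ is_derive (x : R) 1 f (df x),
    is_derive (x : R) 1 g (dg x) & c * dg x <= df x].
  by near=> x; split; near: x.
(* The shift by 1 places the closed segment from B to x strictly beyond A, where the derivatives are
   known. *)
pose B := A + 1.
pose k x := f x - c * g x.
have kder x : A < x -> is_derive (x : R) 1 k (df x - c * dg x).
  by move=> /HA[fx gx _]; apply: is_deriveB.
have kincr x : B < x -> k B <= k x.
  have AB : A < B by rewrite ltrDl.
  move=> Bx; have [y|y|y] :=
    @MVT_segment _ k (fun y => df y - c * dg y) B x (ltW Bx).
  - by rewrite in_itv/= => /andP[By _]; apply: kder; exact: lt_trans By.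
  - apply: derivable_within_continuous => z.
    by rewrite in_itv/= => /andP[Bz _]; have [] := kder _ (lt_le_trans AB Bz).
  - rewrite in_itv/= => /andP[By _] kE.
    have [_ _ cdfy] := HA _ (lt_le_trans AB By).
    by rewrite -subr_ge0 kE mulr_ge0 ?subr_ge0 ?(ltW Bx).
have /cvgryPgt gyA := gy; near=> x.
have gx0 : 0 < g x by near: x; exact: gyA.
have : k B <= k x.
  by apply: kincr; near: x; exact: nbhs_pinfty_gt (num_real _).
(* Beyond this value of g, (c - c') g x exceeds -k B, which is what c' g x < f x requires. *)
have : `|k B| / (c - c') < g x by near: x; exact: gyA.
rewrite ltr_pdivrMr ?subr_gt0// ltr_pdivlMr// /k.
have := ler_norm (- (k B)); rewrite normrN /k; lra.
Unshelve. all: by end_near. Qed.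

(** Only the denominator has to tend to infinity. Lower bounds on f / g come from
    [ratio_gt_of_derive_ge], and upper bounds from the same lemma applied to -f. *)
Lemma lhopital_pinfty (R : realType) (f df g dg : R -> R) (l : \bar R) :
  (\forall x \near +oo, is_derive (x : R) 1 f (df x)) ->
  (\forall x \near +oo, is_derive (x : R) 1 g (dg x)) ->
  (\forall x \near +oo, 0 < dg x) ->
  g x @[x --> +oo] --> +oo ->
  (df x / dg x)%:E @[x --> +oo] --> l ->
  (f x / g x)%:E @[x --> +oo] --> l.
Proof.
move=> fdf gdg dg0 gy dfl; apply: cvg_EFin_bounds => a.
- move=> al.
  (* The intermediate c provides the strict gap that [ratio_gt_of_derive_ge] consumes; when l is
     infinite, a + 1 serves. *)
  have [c ac cl] : exists2 c, a < c & (c%:E < l)%E.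
    case: l al {dfl} => [r| |//].
      by rewrite lte_fin => ar; exists ((a + r) / 2); rewrite ?lte_fin; lra.
    by exists (a + 1); rewrite ?ltry// ltrDl.
  apply: (ratio_gt_of_derive_ge fdf gdg _ gy ac); near=> x.
  rewrite -ler_pdivlMr; last by near: x.
  by apply/ltW; near: x; exact: (cvg_EFin_gt dfl cl).
- move=> la.
  have [c ac cl] : exists2 c, c < a & (l < c%:E)%E.
    case: l la {dfl} => [r| //|].
      by rewrite lte_fin => ar; exists ((a + r) / 2); rewrite ?lte_fin; lra.
    by exists (a - 1); rewrite ?ltNyr// ltrBlDr ltrDl.
  have fdf' : \forall x \near +oo, is_derive (x : R) 1 (\- f) (- df x).
    by apply: filterS fdf => x; exact: is_deriveN.
  have : \forall x \near +oo, - a < (\- f) x / g x.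
    apply: (@ratio_gt_of_derive_ge _ (\- f) _ g dg _ (- c) fdf' gdg _ gy).
      near=> x; rewrite mulNr lerN2 -ler_pdivrMr; last by near: x.
      by apply/ltW; near: x; exact: (cvg_EFin_lt dfl cl).
    by rewrite ltrN2.
  by apply: filterS => x /=; rewrite mulNr ltrN2.
Unshelve. all: by end_near. Qed.

(** * The functions H and W, their derivatives and the divergence of H *)

Definition arrival_rate (R : realType) (h : R -> R) (x : R) : R :=
  \int[lebesgue_measure]_(y in `[0, x]) h y.

(** A single integral rather than the iterated one, so that it is literally the integral in
    [social_threshold_eq]. *)
Definition excess (R : realType) (h : R -> R) (x : R) : R :=
  \int[lebesgue_measure]_(y in `[0, x]) ((x - y) * h y).

Section Intensity.
Context {R : realType} (h : R -> R).
Hypothesis h_intensity : intensity h.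
Local Notation leb := (@lebesgue_measure R).
Local Notation moment x := (\int[leb]_(y in `[0, x]) (y * h y)).

Lemma intensity_ge0 x : 0 <= x -> 0 <= h x.
Proof. by case: h_intensity => h0 _ _; exact: h0. Qed.

Lemma intensity_measurable x : measurable_fun (`[0, x] : set R) h.
Proof.
case: h_intensity => _ mh _; apply: (measurable_funS _ _ mh) => // y.
by rewrite /= !in_itv/= => /andP[-> _].
Qed.

Lemma intensity_integrable x : 0 <= x -> leb.-integrable `[0, x] (EFin \o h).
Proof.
move=> x0; apply/integrableP; split.
  by apply/measurable_EFinP; exact: intensity_measurable.
case: (h_intensity) => _ _ /(_ _ x0); apply: le_lt_trans.
rewrite le_eqVlt; apply/orP; left; apply/eqP; apply: eq_integral => y.
by rewrite inE/= in_itv/= => /andP[y0 _]; rewrite ger0_norm// intensity_ge0.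
Qed.

Lemma intensity_integrableMl a x : 0 <= x ->
  leb.-integrable `[0, x] (EFin \o (fun y => a * h y)).
Proof.
move=> x0.
have mI : measurable (`[0, x]%classic : set (measurableTypeR R)).
  exact: measurable_itv.
have /= := integrableZl mI a (intensity_integrable x0).
by apply: eq_integrable => //= y _; rewrite EFinM.
Qed.

Lemma moment_integrable x : 0 <= x ->
  leb.-integrable `[0, x] (EFin \o (fun y => y * h y)).
Proof.
move=> x0; apply: le_integrable (intensity_integrableMl x x0) => //.
  by apply/measurable_EFinP/measurable_funM => //; exact: intensity_measurable.
move=> y; rewrite /= in_itv/= => /andP[y0 yx].
by rewrite lee_fin !normrM ler_wpM2r// !ger0_norm// (le_trans y0).
Qed.

Lemma Rintegral_affineM a x : 0 <= x ->
  \int[leb]_(y in `[0, x]) ((a - y) * h y) = a * arrival_rate h x - moment x.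
Proof.
move=> x0; rewrite /arrival_rate.
rewrite -RintegralZl//; last exact: intensity_integrable.
rewrite -RintegralB//.
- by apply: eq_Rintegral => y _; rewrite mulrBl.
- exact: intensity_integrableMl.
- exact: moment_integrable.
Qed.

(** Split a - y as (a - x) + (x - y). With a = xe this expresses both benefit numerators through H
    and W. *)
Lemma Rintegral_affine_excess a x : 0 <= x ->
  \int[leb]_(y in `[0, x]) ((a - y) * h y) =
  (a - x) * arrival_rate h x + excess h x.
Proof. by move=> x0; rewrite /excess !Rintegral_affineM//; ring. Qed.

Lemma arrival_rate_ge0 x : 0 <= arrival_rate h x.
Proof.
apply: Rintegral_ge0 => y.
by rewrite /= in_itv/= => /andP[y0 _]; exact: intensity_ge0.
Qed.

Lemma arrival_rate_ndecr x y : 0 <= x -> x <= y ->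
  arrival_rate h x <= arrival_rate h y.
Proof.
move=> x0 xy; rewrite -subr_ge0 /arrival_rate Rintegral_itvB ?bnd_simp//.
  apply: Rintegral_ge0 => z; rewrite /= in_itv/= => /andP[xz _].
  by rewrite intensity_ge0// (le_trans x0)// ltW.
by apply: intensity_integrable; exact: le_trans xy.
Qed.

Lemma excess_le x : 0 <= x -> excess h x <= x * arrival_rate h x.
Proof.
move=> x0; rewrite /excess Rintegral_affineM// gerBl.
apply: Rintegral_ge0 => y; rewrite /= in_itv/= => /andP[y0 _].
by rewrite mulr_ge0 ?intensity_ge0.
Qed.

Lemma is_derive_arrival_rate x : 0 < x -> {for x, continuous h} ->
  is_derive x 1 (arrival_rate h) (h x).
Proof.
(* The fundamental theorem is applied on [0, x + 1], which has x in its interior. *)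
move=> x0 hx; have xx1 : x < x + 1 by rewrite ltrDl.
have [|dF <-] := continuous_FTC1_closed xx1 _ x0 hx.
  by apply: intensity_integrable; rewrite addr_ge0// ltW.
by rewrite derive1E; exact/derivableP.
Qed.

(** The integrand itself depends on x, so W is first written as x H(x) minus the first moment; the
    two terms x h(x) then cancel in the derivative. *)
Lemma is_derive_excess x : 0 < x -> {for x, continuous h} ->
  is_derive x 1 (excess h) (arrival_rate h x).
Proof.
move=> x0 hx; have xx1 : x < x + 1 by rewrite ltrDl.
have cm : {for x, continuous (fun y : R => y * h y)}.
  by apply: cvgM => //; exact: cvg_id.
have [|dF dFE] := continuous_FTC1_closed xx1 _ x0 cm.
  by apply: moment_integrable; rewrite addr_ge0// ltW.
have dM : is_derive x 1 (fun x : R => moment x) (x * h x).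
  by rewrite -dFE derive1E; exact/derivableP.
have dH := is_derive_arrival_rate x0 hx.
have : is_derive x 1 (fun y : R => y * arrival_rate h y - moment y)
    (arrival_rate h x).
  have := is_deriveB (is_deriveM (is_derive_id x 1) dH) dM.
  by move/is_derive_eq; apply; rewrite /GRing.scale/=; ring.
(* That expression for W is available only at nonnegative points, hence on a neighbourhood of x >
   0. *)
apply: near_eq_is_derive.
near=> y; rewrite /excess Rintegral_affineM//; apply: ltW.
by near: y; exact: lt_nbhsr.
Unshelve. all: by end_near. Qed.

Hypothesis h_total : (\int[leb]_(y in `[0%R, +oo[) (h y)%:E = +oo)%E.

Lemma arrival_rate_cvgy : arrival_rate h x @[x --> +oo] --> +oo.
Proof.
(* Monotone convergence over the intervals [0, n + 1]; monotonicity of H then passes from integers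
   to reals. *)
have cv : (\int[leb]_(y in `[0%R, n.+1%:R]) (h y)%:E)%E @[n --> \oo] -->
    +oo%E.
  rewrite -h_total itv0y_bigcup0S.
  apply: ge0_nondecreasing_set_cvg_integral => //.
  - move=> m n mn; apply/subsetPset => y; rewrite /= !in_itv/= => /andP[-> ym].
    by rewrite (le_trans ym)// ler_nat.
  - by move=> n; apply/measurable_EFinP; exact: intensity_measurable.
  - move=> n y; rewrite /= in_itv/= => /andP[y0 _].
    by rewrite lee_fin intensity_ge0.
apply/cvgryPgt => A; have /cvgeyPgt/(_ A)[n _ /(_ n (leqnn _))/= An] := cv.
near=> x; apply: (lt_le_trans _ (arrival_rate_ndecr (ler0n _ n.+1) _)).
  rewrite -lte_fin /arrival_rate fineK//.
  by apply: integrable_fin_num => //; exact: intensity_integrable.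
by near: x; exact: nbhs_pinfty_ge (num_real _).
Unshelve. all: by end_near. Qed.

End Intensity.

(** * Growth of h, H and W by repeated use of l'Hopital's rule *)

Section Asymptotics.
Context {R : realType} (mu ct : R) (h : R -> R) (l : \bar R).
Hypotheses (mu_gt0 : 0 < mu) (ct_gt0 : 0 < ct) (h_intensity : intensity h).
Hypothesis h_total :
  (\int[lebesgue_measure]_(y in `[0%R, +oo[) (h y)%:E = +oo)%E.
Hypothesis h_smooth : \forall x \near +oo, derivable h x 1 /\ h x != 0.
Hypothesis h_lim : (x * derive1 h x / h x)%:E @[x --> +oo] --> l.

Let rate_cvgy := arrival_rate_cvgy h_intensity h_total.

Let h_gt0 : \forall x \near +oo, 0 < h x.
Proof.
near=> x; have [_ hx] : derivable h x 1 /\ h x != 0 by near: x.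
by rewrite lt_neqAle eq_sym hx intensity_ge0.
Unshelve. all: by end_near. Qed.

Let is_derive_rate :
  \forall x \near +oo, is_derive (x : R) 1 (arrival_rate h) (h x).
Proof.
near=> x; apply: is_derive_arrival_rate => //.
apply/differentiable_continuous/derivable1_diffP.
by have [] : derivable h x 1 /\ h x != 0 by near: x.
Unshelve. all: by end_near. Qed.

Let is_derive_exc :
  \forall x \near +oo, is_derive (x : R) 1 (excess h) (arrival_rate h x).
Proof.
near=> x; apply: is_derive_excess => //.
apply/differentiable_continuous/derivable1_diffP.
by have [] : derivable h x 1 /\ h x != 0 by near: x.
Unshelve. all: by end_near. Qed.

(** The quotient of derivatives is H / 1, which tends to infinity. *)
Lemma excess_over_id_cvgy : (excess h x / x)%:E @[x --> +oo] --> +oo%E.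
Proof.
apply: (lhopital_pinfty is_derive_exc (g := id) (dg := cst 1)).
- by apply: nearW => x; exact: is_derive_id.
- by apply: nearW => x; exact: ltr01.
- exact: cvg_id.
- by under eq_cvg do rewrite divr1; apply/cvgeryP.
Qed.

Lemma excess_cvgy : excess h x @[x --> +oo] --> +oo.
Proof.
apply/cvgryPgt => A; near=> x.
have x0 : 0 < x by [].
have Ax : A < x by near: x; exact: nbhs_pinfty_gt (num_real _).
have : 1 < excess h x / x.
  by near: x; apply: (cvg_EFin_gt excess_over_id_cvgy); rewrite ltry.
by rewrite ltr_pdivlMr// mul1r; exact: lt_trans.
Unshelve. all: by end_near. Qed.

(** Here (x h)' / H' = 1 + x h' / h. Adding the finite number 1 is always well defined, so an
    infinite l is covered. *)
Lemma intensity_ratio_cvg : (x * h x / arrival_rate h x)%:E @[x --> +oo] -->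
  (1 + l)%E.
Proof.
apply: (lhopital_pinfty (f := fun x => x * h x)
  (df := fun x => h x + x * derive1 h x) _ is_derive_rate h_gt0 rate_cvgy).
  near=> x; have [dh _] : derivable h x 1 /\ h x != 0 by near: x.
  have := is_deriveM (is_derive_id x 1) (derivableP dh).
  by move/is_derive_eq; apply; rewrite derive1E /GRing.scale/=; ring.
have : (1%:E + (x * derive1 h x / h x)%:E)%E @[x --> +oo] --> (1 + l)%E.
  by apply: cvgeD => //; exact: cvg_cst.
apply: cvg_trans; apply: near_eq_cvg; near=> x.
have hx : 0 < h x by near: x.
by rewrite -EFinD mulrDl divff// gt_eqF.
Unshelve. all: by end_near. Qed.

(** Likewise (x H)' / W' = 1 + x h / H. *)
Lemma rate_ratio_cvg : (x * arrival_rate h x / excess h x)%:E @[x --> +oo] -->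
  (2%:E + l)%E.
Proof.
have rate_gt0 : \forall x \near +oo, 0 < arrival_rate h x.
  by move/cvgryPgt : rate_cvgy; exact.
apply: (lhopital_pinfty (f := fun x => x * arrival_rate h x)
  (df := fun x => arrival_rate h x + x * h x) _ is_derive_exc rate_gt0
  excess_cvgy).
  near=> x; have dH : is_derive x 1 (arrival_rate h) (h x) by near: x.
  have := is_deriveM (is_derive_id x 1) dH.
  by move/is_derive_eq; apply; rewrite /GRing.scale/=; ring.
have -> : (2%:E + l = 1 + (1 + l))%E.
  by rewrite addeA; congr (_ + _)%E; rewrite -EFinD; congr EFin; ring.
have : (1%:E + (x * h x / arrival_rate h x)%:E)%E @[x --> +oo] -->
    (1 + (1 + l))%E.
  by apply: cvgeD => //; [exact: cvg_cst|exact: intensity_ratio_cvg].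
apply: cvg_trans; apply: near_eq_cvg; near=> x.
have Hx : 0 < arrival_rate h x by near: x.
by rewrite -EFinD mulrDl divff// gt_eqF.
Unshelve. all: by end_near. Qed.

(** * The optimal threshold and the price of anarchy for large xe *)

Let s := social_threshold h mu.

Let threshold_eq xe : 0 <= xe ->
  0 <= s xe /\ mu * (xe - s xe) = excess h (s xe).
Proof.
move=> xe0; have [s0 sE] := social_thresholdP mu_gt0 h_intensity xe0.
split=> //; rewrite {1}sE -/s -/(excess h (s xe)).
by rewrite addrK mulVKf// gt_eqF.
Qed.

(** A threshold s <= B with B >= 0 would force mu (xe - s) = W(s) <= B H(B), hence xe <= B + B H(B)
    / mu, which fails for large xe. *)
Lemma social_threshold_cvgy : s xe @[xe --> +oo] --> +oo.
Proof.
apply/cvgryPgt => A; pose B := Num.max A 0.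
have B0 : 0 <= B by rewrite le_max lexx orbT.
near=> xe; apply: (le_lt_trans (_ : A <= B)); first by rewrite le_max lexx.
have xe0 : 0 <= xe by [].
have [s0 sE] := threshold_eq xe0; rewrite ltNge; apply/negP => sB.
have : B + mu^-1 * (B * arrival_rate h B) < xe.
  by near: xe; exact: nbhs_pinfty_gt (num_real _).
apply/negP; rewrite -leNgt -lerBlDl.
rewrite -(ler_pM2l mu_gt0) mulVKf ?gt_eqF//.
apply: (@le_trans _ _ (mu * (xe - s xe))).
  by rewrite ler_pM2l// lerD2l lerN2.
rewrite sE (le_trans (excess_le h_intensity s0))//.
by rewrite ler_pM// ?arrival_rate_ge0 ?arrival_rate_ndecr.
Unshelve. all: by end_near. Qed.

(** Since s tends to infinity, W(s) / s eventually exceeds mu / e; with W(s) = mu (xe - s) this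
    reads s < e (xe - s) <= e xe. *)
Lemma social_threshold_ratio_cvg0 : s xe / xe @[xe --> +oo] --> 0.
Proof.
apply/cvgrPdist_lt => e e0.
have large : \forall x \near +oo, mu / e < excess h x / x.
  by apply: (cvg_EFin_gt excess_over_id_cvgy); rewrite ltry.
have s_large : \forall xe \near +oo, mu / e < excess h (s xe) / s xe :=
  social_threshold_cvgy large.
near=> xe; have xe0 : 0 < xe by [].
have [s0 sE] := threshold_eq (ltW xe0).
rewrite sub0r normrN ger0_norm ?divr_ge0 ?(ltW xe0)//.
have s_gt0 : 0 < s xe.
  by near: xe; move/cvgryPgt : social_threshold_cvgy; exact.
have : mu / e < excess h (s xe) / s xe by near: xe.
rewrite ltr_pdivlMr// -sE -mulrA ltr_pM2l// ltr_pdivrMl// ltr_pdivrMr//.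
by move=> /lt_le_trans; apply; rewrite ler_pM2l// gerBl.
Unshelve. all: by end_near. Qed.

Lemma PoA_near : \forall xe \near +oo, PoA h mu ct xe =
  (1 - s xe / xe) * (1 + mu / arrival_rate h xe) *
  (xe * arrival_rate h xe / excess h xe).
Proof.
near=> xe.
have xe0 : 0 < xe by near: xe; exact: nbhs_pinfty_gt (num_real _).
have H0 : 0 < arrival_rate h xe.
  by near: xe; move/cvgryPgt : rate_cvgy; exact.
have W0 : 0 < excess h xe by near: xe; move/cvgryPgt : excess_cvgy; exact.
have [s0 sE] := threshold_eq (ltW xe0).
have den t : 0 < 1 + mu^-1 * arrival_rate h t.
  by rewrite ltr_wpDr// mulr_ge0 ?arrival_rate_ge0// invr_ge0 ltW.
rewrite /PoA /social_benefit -/s -!/(arrival_rate h _).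
rewrite !Rintegral_affine_excess// ?(ltW xe0)// -sE subrr mul0r add0r.
(* The last factor is the denominator of the optimal benefit, which therefore equals ct mu (xe -
   s). *)
have -> : (xe - s xe) * arrival_rate h (s xe) + mu * (xe - s xe) =
    mu * (xe - s xe) * (1 + mu^-1 * arrival_rate h (s xe)).
  by field; rewrite gt_eqF.
rewrite mulrA mulfK ?gt_eqF//; field.
by rewrite !gt_eqF// addr_gt0.
Unshelve. all: by end_near. Qed.

Lemma PoA_cvg : (PoA h mu ct xe)%:E @[xe --> +oo] --> (2%:E + l)%E.
Proof.
have : (1 - s xe / xe) * (1 + mu / arrival_rate h xe) @[xe --> +oo]
    --> ((1 - 0) * (1 + mu * 0) : R).
  apply: cvgM.
    by apply: cvgB; [exact: cvg_cst|exact: social_threshold_ratio_cvg0].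
  apply: cvgD; first exact: cvg_cst.
  apply: cvgM; first exact: cvg_cst.
  (* 1 / H tends to 0 because it is eventually positive and its inverse H tends to infinity. *)
  apply/cvgrVy.
    have /cvgryPgt/(_ 0) := rate_cvgy.
    by apply: filterS => x; rewrite invr_gt0.
  under eq_cvg do rewrite /= invrK.
  exact: rate_cvgy.
rewrite subr0 mulr0 addr0 mulr1 => c1.
have : (((1 - s xe / xe) * (1 + mu / arrival_rate h xe))%:E *
    (xe * arrival_rate h xe / excess h xe)%:E)%E @[xe --> +oo] -->
    (1 * (2%:E + l))%E.
  apply: cvgeM.
  (* The first factor has the nonzero finite limit 1, so the product is never of the form 0 times
     infinity. *)
  - by rewrite mule_defE onee_eq0/= andbF.
  - by apply: cvg_EFin => //; exact: nearW.
  - exact: rate_ratio_cvg.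
rewrite mul1e; apply: cvg_trans; apply: near_eq_cvg.
by apply: filterS PoA_near => xe ->; rewrite EFinM.
Qed.

End Asymptotics.

Theorem theorem3p17 (R : realType) (mu ct : R) (h : R -> R) (l : \bar R)
  (mu_gt0 : 0 < mu) (ct_gt0 : 0 < ct)
  (h_intensity : intensity h)
  (h_total : (\int[lebesgue_measure]_(y in `[0%R, +oo[) (h y)%:E = +oo)%E)
  (h_smooth : \forall x \near +oo%R, derivable h x 1 /\ h x != 0)
  (h_lim : (x * derive1 h x / h x)%:E @[x --> +oo%R] --> l) :
  (PoA h mu ct xe)%:E @[xe --> +oo%R] --> (2%:E + l)%E.
Proof. exact: PoA_cvg. Qed.
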